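(* Let $k$ be a field, $X$ a well-ordered set, and $D(X)$ the free dialgebra over $k$ generated by $X$. The set of elements $$x_{-m}\succ(x_{-m+1}\succ\cdots\succ(x_0\prec(x_1\succ\cdots\succ(x_{n-1}\succ x_n)\cdots))\cdots),\qquad n,m\in\mathbb N=\{0,1,2,\dots\},\ x_i\in X,$$ is a $k$-basis of $D(X)=L(X|S)$. Moreover this set (as a set of normal words) equals $Irr(S_1)$, where $S_1=S\cup F_5$.
   Context: In the displayed words, for $n=0$ the word is $x_{-m}\succ(x_{-m+1}\succ\cdots\succ(x_{-1}\succ x_0)\cdots)$, and for $m=0$ it is $x_0\prec(x_1\succ\cdots\succ(x_{n-1}\succ x_n)\cdots)$ (just $x_0$ if also $n=0$). A dialgebra is a $k$-space with two bilinear associative operations $\prec,\succ$ satisfying $a\prec(b\succ c)=a\prec b\prec c$, $(a\prec b)\succ c=a\succ b\succ c$, $a\succ(b\prec c)=(a\succ b)\prec c$. An $L$-algebra is a $k$-space with two bilinear operations satisfying $(x\succ y)\prec z=x\succ(y\prec z)$. Let $\Omega=\{\prec,\succ\}$. $(X,\Omega)$ (the $\Omega$-words) is the smallest set of formal expressions containing $X$ and closed under $u,v\mapsto u\prec v$, $u\succ v$. Normal words: $x\in X$; $v\succ w$ with $v,w$ normal; $v\prec w$ with $v,w$ normal and $v$ not of the form $v_1\succ v_2$. $N(X)$ is the set of normal words. The free $L$-algebra $L(X)$ has $k$-basis $N(X)$ and operations given for $u,v\in N(X)$ by: $u\succ v$ is the word $u\succ v$; $u\prec v=[u\prec v]$,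 where $[u\prec v]$ is the word $u\prec v$ if $u\in X$ or $u=u_1\prec u_2$, and $[u\prec v]=u_1\succ[u_2\prec v]$ if $u=u_1\succ u_2$. $S=F_1\cup F_2\cup F_3\cup F_4\subset L(X)$, where, with $a,b,c$ ranging over $N(X)$, $F_1=\{a\prec(b\prec c)-a\prec(b\succ c)\}$, $F_2=\{(a\prec b)\succ c-a\succ(b\succ c)\}$, $F_3=\{(a\prec b)\prec c-a\prec(b\succ c)\}$, $F_4=\{(a\succ b)\succ c-a\succ(b\succ c)\}$; $F_5=\{a_1\prec(a_2\succ(a_3\succ\cdots\succ(a_{n+2}\prec a_{n+3})\cdots))-a_1\prec(a_2\succ(a_3\succ\cdots\succ(a_{n+2}\succ a_{n+3})\cdots))\mid n\ge1,\ a_i\in N(X)\}$; all expressions are evaluated in $L(X)$. $L(X|S)=L(X)/Id(S)$, with $Id(S)$ the ideal generated by $S$, is the free dialgebra $D(X)$. Ordering on $N(X)$: $|u|$ is the number of occurrences of elements of $X$ in $u$; $\delta_1$ denotes $\succ$, $\delta_2$ denotes $\prec$, $\delta_1<\delta_2$. Put $wt(x)=(1,x)$ for $x\in X$ and $wt(u)=(|u|,\delta_i,u_1,u_2)$ for $u=\delta_i(u_1,u_2)$; $u>v$ iff $wt(u)>wt(v)$ lexicographically, recursively on $|u|+|v|$. For $0\ne f\in L(X)$, $\overline f$ is the largest normal word occurring in $f$ with nonzero coefficient. A $\star$-$\Omega$-word $v$ is an element of $(X\cup\{\star\},\Omega)$ with exactly one occurrence of $\star\notin X$, and $v|_{\overline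 s}$ is the $\Omega$-word obtained by substituting $\overline s$ for $\star$. $Irr(S_1)$ is the set of $u\in N(X)$ that are not of the form $v|_{\overline s}$ with $s\in S_1$ and $v$ a $\star$-$\Omega$-word (with $v|_{\overline s}\in N(X)$). *)

(* Defs.v *)
From HB Require Import structures.
From mathcomp Require Import all_boot all_order all_algebra.
From mathcomp Require Import finmap boolp.
From mathcomp.multinomials Require Import monalg.

Set Implicit Arguments.
Unset Strict Implicit.
Unset Printing Implicit Defensive.

Import Order.TTheory GRing.Theory.

Local Open Scope ring_scope.
Local Open Scope quotient_scope.

(* [Prec u v] and [Succ u v] are the formal expressions u \prec v and
   u \succ v, so that [oword X] is the set (X, Omega). *)
Inductive oword (X : Type) : Type :=
| Var of X
| Prec of oword X & oword X
| Succ of oword X & oword X.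

Section OwordChoice.
Variable X : Type.

Fixpoint oword_encode (w : oword X) : GenTree.tree X :=
  match w with
  | Var x => GenTree.Leaf x
  | Prec u v => GenTree.Node 0 [:: oword_encode u; oword_encode v]
  | Succ u v => GenTree.Node 1 [:: oword_encode u; oword_encode v]
  end.

Fixpoint oword_decode (t : GenTree.tree X) : option (oword X) :=
  match t with
  | GenTree.Leaf x => Some (Var x)
  | GenTree.Node 0 [:: t1; t2] =>
      if (oword_decode t1, oword_decode t2) is (Some u, Some v)
      then Some (Prec u v) else None
  | GenTree.Node 1 [:: t1; t2] =>
      if (oword_decode t1, oword_decode t2) is (Some u, Some v)
      then Some (Succ u v) else None
  | _ => None
  end.

Lemma oword_encodeK : pcancel oword_encode oword_decode.
Proof. by elim=> [x|u IHu v IHv|u IHu v IHv] //=; rewrite IHu IHv. Qed.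

End OwordChoice.

HB.instance Definition _ (X : eqType) :=
  Equality.copy (oword X) (pcan_type (@oword_encodeK X)).
HB.instance Definition _ (X : choiceType) :=
  Choice.copy (oword X) (pcan_type (@oword_encodeK X)).

(* The value of a word in a set [A] with two operations, the letters being
   sent to [A] by [i]. *)
Fixpoint oeval (X A : Type) (prec succ : A -> A -> A) (i : X -> A)
    (w : oword X) : A :=
  match w with
  | Var x => i x
  | Prec u v => prec (oeval prec succ i u) (oeval prec succ i v)
  | Succ u v => succ (oeval prec succ i u) (oeval prec succ i v)
  end.

Definition is_succ (X : Type) (w : oword X) : bool :=
  if w is Succ _ _ then true else false.

Fixpoint normal (X : Type) (w : oword X) : bool :=
  match w with
  | Var _ => true
  | Prec u v => [&& normal u, normal v & ~~ is_succ u]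
  | Succ u v => normal u && normal v
  end.

(* For normal [u] and [v], the normal word [u \prec v] equal to their product
   in L(X). *)
Fixpoint wprec (X : Type) (u v : oword X) : oword X :=
  if u is Succ u1 u2 then Succ u1 (wprec u2 v) else Prec u v.

Lemma normal_wprec (X : Type) (u v : oword X) :
  normal u -> normal v -> normal (wprec u v).
Proof.
move=> + nv; elim: u => [x|u1 _ u2 _|u1 _ u2 IH2] /= => [_|nu|/andP[n1 n2]].
- by rewrite nv.
- by rewrite nu nv.
- by rewrite n1 IH2.
Qed.

Record nword (X : Type) : Type :=
  NWord { nword_val :> oword X; nwordP : normal nword_val }.

HB.instance Definition _ (X : Type) := [isSub for @nword_val X].
HB.instance Definition _ (X : eqType) := [Equality of nword X by <:].
HB.instance Definition _ (X : choiceType) := [Choice of nword X by <:].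

Definition nvar (X : Type) (x : X) : nword X := @NWord X (Var x) isT.

Definition nprec (X : Type) (u v : nword X) : nword X :=
  NWord (normal_wprec (nwordP u) (nwordP v)).

Definition nsucc (X : Type) (u v : nword X) : nword X :=
  @NWord X (Succ u v) (introT andP (conj (nwordP u) (nwordP v))).

Notation freeL k X := {malg k[nword X]}.

Section FreeL.
Variables (k : fieldType) (X : choiceType).
Local Notation L := (freeL k X).

Definition bilin_ext (op : nword X -> nword X -> nword X) (f g : L) : L :=
  \sum_(u <- msupp f) \sum_(v <- msupp g) << f@_u * g@_v *g op u v >>.

Lemma bilin_extEw (op : nword X -> nword X -> nword X) (A B : {fset nword X})
    (f g : L) :
  (msupp f `<=` A)%fset -> (msupp g `<=` B)%fset ->
  bilin_ext op f g =
    \sum_(u <- A) \sum_(v <- B) << f@_u * g@_v *g op u v >>.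
Proof.
move=> fA gB; rewrite /bilin_ext.
have eqB u : \sum_(v <- msupp g) << f@_u * g@_v *g op u v >>
           = \sum_(v <- B) << f@_u * g@_v *g op u v >> :> L.
  apply: big_fset_incl => // v _ /mcoeff_outdom ->.
  by rewrite mulr0 monalgU0.
under eq_bigr => u _ do rewrite eqB.
apply: big_fset_incl => // u _ /mcoeff_outdom ->.
by rewrite big1 // => v _; rewrite mul0r monalgU0.
Qed.

Lemma malgUZ (c a : k) (u : nword X) : << c * a *g u >> = c *: << a *g u >> :> L.
Proof. by apply/malgP => v; rewrite [LHS]mcoeffU (mcoeffZ c << a *g u >>) mcoeffU mulrnAr. Qed.

Lemma bilin_ext_linearl (op : nword X -> nword X -> nword X) (h : L) :
  linear (bilin_ext op ^~ h).
Proof.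
move=> c f g; set A := (msupp f `|` msupp g `|` msupp (c *: f + g))%fset.
have sA : [/\ msupp f `<=` A, msupp g `<=` A & msupp (c *: f + g) `<=` A]%fset.
  by split; apply/fsubsetP => x xf; rewrite !inE xf ?orbT.
have [sf sg sfg] := sA; have sh := fsubset_refl (msupp h).
rewrite (bilin_extEw op sf sh) (bilin_extEw op sg sh) (bilin_extEw op sfg sh).
rewrite scaler_sumr -big_split /=; apply: eq_bigr => u _.
rewrite scaler_sumr -big_split /=; apply: eq_bigr => v _.
by rewrite mcoeffD (mcoeffZ c f) mulrDl -mulrA monalgUD (malgUZ c).
Qed.

Lemma bilin_ext_linearr (op : nword X -> nword X -> nword X) (h : L) :
  linear (bilin_ext op h).
Proof.
move=> c f g; set A := (msupp f `|` msupp g `|` msupp (c *: f + g))%fset.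
have sA : [/\ msupp f `<=` A, msupp g `<=` A & msupp (c *: f + g) `<=` A]%fset.
  by split; apply/fsubsetP => x xf; rewrite !inE xf ?orbT.
have [sf sg sfg] := sA; have sh := fsubset_refl (msupp h).
rewrite (bilin_extEw op sh sf) (bilin_extEw op sh sg) (bilin_extEw op sh sfg).
rewrite scaler_sumr -big_split /=; apply: eq_bigr => u _.
rewrite scaler_sumr -big_split /=; apply: eq_bigr => v _.
by rewrite mcoeffD (mcoeffZ c f) mulrDr mulrCA monalgUD (malgUZ c).
Qed.

Definition lprec : L -> L -> L := bilin_ext (@nprec X).
Definition lsucc : L -> L -> L := bilin_ext (@nsucc X).

Definition is_ideal (J : L -> Prop) : Prop :=
  [/\ J 0,
      forall (c : k) f g, J f -> J g -> J (c *: f + g) &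
      forall f g, J f ->
        [/\ J (lprec f g), J (lprec g f), J (lsucc f g) & J (lsucc g f)]].

Definition Id (S : L -> Prop) (f : L) : Prop :=
  forall J : L -> Prop, is_ideal J -> (forall s, S s -> J s) -> J f.

Lemma Id_ideal (S : L -> Prop) : is_ideal (Id S).
Proof.
split=> [J [] //|c f g If Ig J iJ sJ|f g If].
  by case: (iJ) => _ + _; apply; [exact: If|exact: Ig].
by split=> J iJ sJ; case: (iJ) => _ _ /(_ f g (If J iJ sJ)) [].
Qed.

Definition Idb (S : L -> Prop) : {pred L} := fun f => `[< Id S f >].

Lemma Idb_zmod_closed (S : L -> Prop) : zmod_closed (Idb S).
Proof.
have [I0 IZ _] := Id_ideal S; split=> [|f g /asboolP If /asboolP Ig].
  exact/asboolP.
by apply/asboolP; rewrite addrC -scaleN1r; apply: IZ.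
Qed.

HB.instance Definition _ (S : L -> Prop) :=
  GRing.isZmodClosed.Build L (Idb S) (Idb_zmod_closed S).

End FreeL.

Section PresL.
Variables (k : fieldType) (X : choiceType) (S : freeL k X -> Prop).
Local Notation L := (freeL k X).

(* L(X|S) = L(X) / Id(S) *)
Definition presL : Type := Quotient.quot (Idb S).

HB.instance Definition _ := GRing.Zmodule.on presL.
HB.instance Definition _ := ZmodQuotient.on presL.

Definition toQ (f : L) : presL := \pi_presL f.

Lemma toQP (f g : L) : toQ f = toQ g <-> Id S (f - g).
Proof.
have E : (`[< Id S (f - g) >]) = (toQ f == toQ g).
  exact: (Quotient.idealrBE (Idb S) f g).
split=> [/eqP|I]; first by rewrite -E => /asboolP.
by apply/eqP; rewrite -E; apply/asboolP.
Qed.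

Lemma reprQ (x : presL) : toQ (repr x) = x.
Proof. exact: reprK. Qed.

Lemma toQD (f g : L) : toQ (f + g) = toQ f + toQ g.
Proof. by rewrite /toQ pi_addr. Qed.

Definition scaleQ (c : k) (x : presL) : presL := toQ (c *: repr x).
Definition precQ (x y : presL) : presL := toQ (lprec (repr x) (repr y)).
Definition succQ (x y : presL) : presL := toQ (lsucc (repr x) (repr y)).

Lemma toQZ (c : k) (f : L) : toQ (c *: f) = scaleQ c (toQ f).
Proof.
have [I0 IZ _] := Id_ideal S.
have /toQP I : toQ f = toQ (repr (toQ f)) by rewrite reprQ.
by apply/toQP; rewrite -scalerBr -[_ *: _]addr0; apply: IZ.
Qed.

Fact scaleQA a b (x : presL) : scaleQ a (scaleQ b x) = scaleQ (a * b) x.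
Proof. by rewrite -[x]reprQ -!toQZ scalerA. Qed.

Fact scaleQ1 : left_id 1 scaleQ.
Proof. by move=> x; rewrite -[x]reprQ -toQZ scale1r. Qed.

Fact scaleQDr : right_distributive scaleQ +%R.
Proof.
by move=> c x y; rewrite -[x]reprQ -[y]reprQ -toQD -!toQZ -toQD scalerDr.
Qed.

Fact scaleQDl (x : presL) : {morph scaleQ^~ x : a b / a + b}.
Proof. by move=> a b; rewrite -[x]reprQ -!toQZ -toQD scalerDl. Qed.

HB.instance Definition _ := GRing.Zmodule_isLmodule.Build k presL
  scaleQA scaleQ1 scaleQDr scaleQDl.

Lemma toQ_linear : linear toQ.
Proof. by move=> c f g; rewrite toQD toQZ. Qed.

Lemma toQ_bilin (op : L -> L -> L) :
    (forall h, linear (op^~ h)) -> (forall h, linear (op h)) ->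
    (forall f g, Id S f -> Id S (op f g)) ->
    (forall f g, Id S f -> Id S (op g f)) ->
  forall f g, toQ (op (repr (toQ f)) (repr (toQ g))) = toQ (op f g).
Proof.
have BE (F : L -> L) : linear F -> forall f g, F f - F g = F (f - g).
  move=> lF f g; have -> : f - g = -1 *: g + f by rewrite scaleN1r addrC.
  by rewrite lF scaleN1r addrC.
move=> linl linr Il Ir f g; set f' := repr _; set g' := repr _.
have /toQP ff : toQ f' = toQ f by rewrite reprQ.
have /toQP gg : toQ g' = toQ g by rewrite reprQ.
transitivity (toQ (op f g')); apply/toQP.
  by rewrite (BE _ (linl g')); apply: Il.
by rewrite (BE _ (linr f)); apply: Ir.
Qed.

Lemma toQ_prec (f g : L) : toQ (lprec f g) = precQ (toQ f) (toQ g).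
Proof.
have [_ _ I] := Id_ideal S; apply: esym; apply: (@toQ_bilin (@lprec k X)).
- exact: bilin_ext_linearl.
- exact: bilin_ext_linearr.
- by move=> f1 h I1; have [] := I _ h I1.
- by move=> f1 h I1; have [] := I _ h I1.
Qed.

Lemma toQ_succ (f g : L) : toQ (lsucc f g) = succQ (toQ f) (toQ g).
Proof.
have [_ _ I] := Id_ideal S; apply: esym; apply: (@toQ_bilin (@lsucc k X)).
- exact: bilin_ext_linearl.
- exact: bilin_ext_linearr.
- by move=> f1 h I1; have [] := I _ h I1.
- by move=> f1 h I1; have [] := I _ h I1.
Qed.

Definition genQ (x : X) : presL := toQ << nvar x >>.

End PresL.

Section Relations.
Variables (k : fieldType) (X : choiceType).
Local Notation L := (freeL k X).
Local Notation "u ≺ v" := (lprec u v) (at level 40, left associativity).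
Local Notation "u ≻ v" := (lsucc u v) (at level 40, left associativity).

Definition F1 (f : L) : Prop := exists a b c : nword X,
  f = << a >> ≺ (<< b >> ≺ << c >>) - << a >> ≺ (<< b >> ≻ << c >>).

Definition F2 (f : L) : Prop := exists a b c : nword X,
  f = (<< a >> ≺ << b >>) ≻ << c >> - << a >> ≻ (<< b >> ≻ << c >>).

Definition F3 (f : L) : Prop := exists a b c : nword X,
  f = (<< a >> ≺ << b >>) ≺ << c >> - << a >> ≺ (<< b >> ≻ << c >>).

Definition F4 (f : L) : Prop := exists a b c : nword X,
  f = (<< a >> ≻ << b >>) ≻ << c >> - << a >> ≻ (<< b >> ≻ << c >>).

(* s_1 \succ (s_2 \succ (... \succ (s_n \succ f))) *)
Definition succs (s : seq (nword X)) (f : L) : L :=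
  foldr (fun a g => << a >> ≻ g) f s.

(* [a] is a_1, the nonempty sequence [s] is a_2, ..., a_{n+1}, and [b], [c]
   are a_{n+2}, a_{n+3}. *)
Definition F5 (f : L) : Prop :=
  exists (a : nword X) (s : seq (nword X)) (b c : nword X),
    (1 <= size s)%N /\
    f = << a >> ≺ succs s (<< b >> ≺ << c >>)
      - << a >> ≺ succs s (<< b >> ≻ << c >>).

Definition relS (f : L) : Prop := [\/ F1 f, F2 f, F3 f | F4 f].
Definition relS1 (f : L) : Prop := relS f \/ F5 f.

End Relations.

Notation freeD k X := (presL (@relS k X)).

Section Dialgebra.
Variable k : fieldType.

Definition bilin_op (V : lmodType k) (op : V -> V -> V) : Prop :=
  (forall v, linear (op^~ v)) /\ (forall u, linear (op u)).

Definition is_dialgebra (V : lmodType k) (prec succ : V -> V -> V) : Prop :=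
  [/\ bilin_op prec /\ bilin_op succ,
      associative prec /\ associative succ,
      forall a b c, prec a (succ b c) = prec (prec a b) c,
      forall a b c, succ (prec a b) c = succ (succ a b) c &
      forall a b c, succ a (prec b c) = prec (succ a b) c].

Definition dialgebra_hom (V W : lmodType k) (precV succV : V -> V -> V)
    (precW succW : W -> W -> W) (h : V -> W) : Prop :=
  [/\ linear h,
      forall a b, h (precV a b) = precW (h a) (h b) &
      forall a b, h (succV a b) = succW (h a) (h b)].

Definition is_free_dialgebra (X : Type) (V : lmodType k)
    (prec succ : V -> V -> V) (i : X -> V) : Prop :=
  is_dialgebra prec succ /\
  forall (W : lmodType k) (precW succW : W -> W -> W),
    is_dialgebra precW succW -> forall j : X -> W,
    exists h : V -> W,
      [/\ dialgebra_hom prec succ precW succW h,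
          forall x, h (i x) = j x &
          forall h' : V -> W, dialgebra_hom prec succ precW succW h' ->
            (forall x, h' (i x) = j x) -> forall v, h' v = h v].

Definition is_basis (I : eqType) (V : lmodType k) (e : I -> V) : Prop :=
  (forall (s : seq I) (c : I -> k), uniq s ->
     \sum_(i <- s) c i *: e i = 0 -> {in s, forall i, c i = 0}) /\
  (forall v : V, exists (s : seq I) (c : I -> k),
     v = \sum_(i <- s) c i *: e i).

End Dialgebra.

Section Ordering.
Variables (d : Order.disp_t) (X : orderType d).

Fixpoint wsize (w : oword X) : nat :=
  match w with
  | Var _ => 1
  | Prec u v | Succ u v => wsize u + wsize v
  end.

(* Only a letter has size 1, so for words of equal size the two mixed cases
   with exactly one letter never occur. *)
Fixpoint wlt (u v : oword X) : bool :=
  (wsize u < wsize v)%N ||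
  (wsize u == wsize v) &&
    match u, v with
    | Var x, Var y => (x < y)%O
    | Succ _ _, Prec _ _ => true
    | Prec u1 u2, Prec v1 v2 => wlt u1 v1 || (u1 == v1) && wlt u2 v2
    | Succ u1 u2, Succ v1 v2 => wlt u1 v1 || (u1 == v1) && wlt u2 v2
    | _, _ => false
    end.

(* [u] is the leading word of [f]; the zero element has none. *)
Definition leading (k : fieldType) (f : freeL k X) (u : nword X) : Prop :=
  u \in msupp f /\ forall v, v \in msupp f -> v != u -> wlt v u.

End Ordering.

(* A word over X with an extra letter [None] standing for the star. *)
Fixpoint nstar (X : Type) (v : oword (option X)) : nat :=
  match v with
  | Var o => if o is None then 1 else 0
  | Prec v1 v2 | Succ v1 v2 => nstar v1 + nstar v2
  end.

Definition star_subst (X : Type) (v : oword (option X)) (u : oword X) :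
    oword X :=
  oeval (@Prec X) (@Succ X) (fun o => if o is Some x then Var x else u) v.

Definition Irr (k : fieldType) (d : Order.disp_t) (X : orderType d)
    (T : freeL k X -> Prop) (w : oword X) : Prop :=
  normal w /\
  ~ exists (s : freeL k X) (u : nword X) (v : oword (option X)),
      [/\ T s, leading s u, nstar v = 1%N & w = star_subst v u].

(* x \succ (y_1 \succ (... \succ y_n)) with last letter x when n = 0 *)
Fixpoint succ_comb (X : Type) (x : X) (ys : seq X) : oword X :=
  if ys is y :: ys' then Succ (Var x) (succ_comb y ys') else Var x.

(* The word with x_{-m}, ..., x_{-1} listed by [xs], x_0 given by [x0], and
   x_1, ..., x_n listed by [ys]; [m] and [n] are the sizes of the lists. *)
Definition diword (X : Type) (xs : seq X) (x0 : X) (ys : seq X) : oword X :=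
  foldr (fun x w => Succ (Var x) w)
    (if ys is y :: ys' then Prec (Var x0) (succ_comb y ys') else Var x0) xs.

(* Main.v *)
Require Import Defs.
From mathcomp Require Import all_boot all_order all_algebra.
From mathcomp Require Import finmap boolp.
From mathcomp.multinomials Require Import monalg.

Set Implicit Arguments.
Unset Strict Implicit.
Unset Printing Implicit Defensive.

Import Order.TTheory GRing.Theory.

Local Open Scope ring_scope.

(** Everything rests on the free dimonoid on [X]: the set of triples
    ([xs], [x0], [ys]), that is, of nonempty words in [X] with one marked letter.
    Its two products concatenate the words and keep the marked letter of the left
    factor (for [prec]) or of the right factor (for [succ]).

    The quotient L(X|S) satisfies the dialgebra laws: together with the law of
    L-algebras, which holds in L(X) itself, the relations [F1] to [F4] are an
    equivalent form of these laws on basis words, and trilinearity extends them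
    ([freeD_dialgebra]). Conversely, the evaluation of words in a dialgebra
    extends linearly to a homomorphism from L(X) whose kernel is an ideal containing
    the relations; this gives the universal property ([freeD_free]).

    For the basis, the dialgebra laws alone bring every word to the diword
    of its value in the dimonoid ([oeval_dinf]), so the diwords span. They are
    independent because the linear span of the dimonoid is a dialgebra, and the
    homomorphism to it provided by the universal property sends the diwords to
    pairwise distinct basis vectors ([freeD_basis]).

    The description of the irreducible words is combinatorial. A relation is a
    difference of two normal words, and the larger one is never a diword
    ([rel_words_reducing]); since diwords are closed under taking subwords, a
    diword contains no leading word. Conversely, in a normal word
    that is not a diword, a subword minimal among those that are not diwords is
    the larger word of a relation ([not_di_reducible]). *)

(** * Linear maps determined on a spanning family *)

Definition spans (k : fieldType) (I : Type) (V : lmodType k) (e : I -> V) :=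
  forall v : V, exists (s : seq I) (c : I -> k), v = \sum_(i <- s) c i *: e i.

Lemma linear0_eq (k : fieldType) (U V : lmodType k) (F : U -> V) :
  linear F -> F 0 = 0.
Proof.
by move=> linF; have := linF (-1) 0 0; rewrite scaler0 addr0 scaleN1r addNr.
Qed.

Lemma linear_sum_scale (k : fieldType) (U V : lmodType k) (I : Type)
    (F : U -> V) (s : seq I) (c : I -> k) (e : I -> U) :
  linear F -> F (\sum_(i <- s) c i *: e i) = \sum_(i <- s) c i *: F (e i).
Proof.
move=> linF; elim: s => [|i s IH]; last by rewrite !big_cons linF IH.
by rewrite !big_nil linear0_eq.
Qed.

Lemma spans_linear_eq (k : fieldType) (U V : lmodType k) (I : Type)
    (e : I -> U) (F G : U -> V) :
  spans e -> linear F -> linear G -> (forall i, F (e i) = G (e i)) -> F =1 G.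
Proof.
move=> spe linF linG eFG u; have [s [c ->]] := spe u.
by rewrite !linear_sum_scale //; apply: eq_bigr => i _; rewrite eFG.
Qed.

Lemma spans_malg (k : fieldType) (K : choiceType) :
  spans (fun u : K => << u >> : {malg k[K]}).
Proof.
move=> f; exists (msupp f), (fun u => f@_u); rewrite [LHS]monalgE.
apply: eq_bigr => u _; apply/malgP => v.
by rewrite [RHS](mcoeffZ (f@_u) << u >>) !mcoeffU mulrnAr mulr1.
Qed.

Definition lin_ext (k : fieldType) (K : choiceType) (V : lmodType k)
    (F : K -> V) (f : {malg k[K]}) : V := \sum_(u <- msupp f) f@_u *: F u.

Section LinExt.
Variables (k : fieldType) (K : choiceType) (V : lmodType k).

Lemma lin_extEw (F : K -> V) (f : {malg k[K]}) (A : {fset K}) :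
  (msupp f `<=` A)%fset -> lin_ext F f = \sum_(u <- A) f@_u *: F u.
Proof.
by move=> fA; apply: big_fset_incl => // u _ /mcoeff_outdom ->; rewrite scale0r.
Qed.

Lemma lin_ext_linear (F : K -> V) : linear (lin_ext F).
Proof.
move=> c f g; set A := (msupp f `|` msupp g `|` msupp (c *: f + g))%fset.
have [sf sg sfg] :
    [/\ msupp f `<=` A, msupp g `<=` A & msupp (c *: f + g) `<=` A]%fset.
  by split; apply/fsubsetP => x xf; rewrite !inE xf ?orbT.
rewrite (lin_extEw F sf) (lin_extEw F sg) (lin_extEw F sfg).
rewrite scaler_sumr -big_split; apply: eq_bigr => u _ /=.
by rewrite mcoeffD (mcoeffZ c f) scalerDl scalerA.
Qed.

Lemma lin_extU (F : K -> V) (u : K) : lin_ext F << u >> = F u.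
Proof. by rewrite /lin_ext msuppU oner_eq0 big_seq_fset1 mcoeffUU scale1r. Qed.

(** Repetitions created by a non-injective [phi] are merged by collecting the
    coefficients in a vector with basis [K]. *)
Lemma spans_factor (I : Type) (phi : I -> K) (e : K -> V) :
  spans (e \o phi) -> spans e.
Proof.
move=> spe v; have [s [c ->]] := spe v.
pose f : {malg k[K]} := \sum_(i <- s) c i *: << phi i >>.
exists (msupp f), (fun u => f@_u); rewrite -/(lin_ext e f).
rewrite linear_sum_scale; last exact: lin_ext_linear.
by apply: eq_bigr => i _; rewrite lin_extU.
Qed.

End LinExt.

(** Linear independence is read off in the target of a linear map [h] that sends
    the family to the standard basis. *)
Lemma free_of_malg (k : fieldType) (K : choiceType) (V : lmodType k)
    (e : K -> V) (h : V -> {malg k[K]}) :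
  linear h -> (forall u, h (e u) = << u >>) ->
  forall (s : seq K) (c : K -> k), uniq s ->
    \sum_(u <- s) c u *: e u = 0 -> {in s, forall u, c u = 0}.
Proof.
move=> linh he s c us E u su.
have := congr1 (mcoeff u \o h) E.
rewrite /= linear_sum_scale // linear0_eq // mcoeff0 raddf_sum (bigD1_seq u) //=.
rewrite he (mcoeffZ (c u) << u >>) mcoeffUU mulr1 big1 ?addr0 // => v /negPf vu.
by rewrite he (mcoeffZ (c v) << v >>) mcoeffU vu mulr0.
Qed.

(** * The dialgebra laws on a spanning family *)

(** With [e] the identity these are the laws of a dimonoid, that is, the laws of
    a dialgebra without the linear structure. *)
Definition dimonoid_laws (A I : Type) (prec succ : A -> A -> A) (e : I -> A) :=
  forall a b c : I,
  [/\ prec (e a) (prec (e b) (e c)) = prec (prec (e a) (e b)) (e c),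
      succ (e a) (succ (e b) (e c)) = succ (succ (e a) (e b)) (e c),
      prec (e a) (succ (e b) (e c)) = prec (prec (e a) (e b)) (e c),
      succ (prec (e a) (e b)) (e c) = succ (succ (e a) (e b)) (e c) &
      succ (e a) (prec (e b) (e c)) = prec (succ (e a) (e b)) (e c)].

(** The equations that the relations of L(X|S) and the law of L-algebras give in a
    quotient [q] bring each law to a common form [a _ (b succ c)] or
    [(a succ b) prec c], so they imply the dimonoid laws. *)
Lemma dimonoid_laws_image (I A B : Type) (p s : A -> A -> A)
    (pB sB : B -> B -> B) (q : A -> B) (e : I -> A) :
  (forall a b, q (p a b) = pB (q a) (q b)) ->
  (forall a b, q (s a b) = sB (q a) (q b)) ->
  (forall a b c : I,
    [/\ q (p (e a) (p (e b) (e c))) = q (p (e a) (s (e b) (e c))),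
        q (s (p (e a) (e b)) (e c)) = q (s (e a) (s (e b) (e c))),
        q (p (p (e a) (e b)) (e c)) = q (p (e a) (s (e b) (e c))),
        q (s (s (e a) (e b)) (e c)) = q (s (e a) (s (e b) (e c))) &
        q (s (e a) (p (e b) (e c))) = q (p (s (e a) (e b)) (e c))]) ->
  dimonoid_laws pB sB (fun i => q (e i)).
Proof.
move=> qp qs H a b c; rewrite -!(qp, qs).
by have [-> -> -> -> ->] := H a b c.
Qed.

(** Conversely, a homomorphism [q] to a dimonoid identifies the two sides of each
    relation of L(X|S). *)
Lemma dimonoid_eqs (A B : Type) (p s : A -> A -> A) (pB sB : B -> B -> B)
    (q : A -> B) :
  (forall a b, q (p a b) = pB (q a) (q b)) ->
  (forall a b, q (s a b) = sB (q a) (q b)) ->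
  dimonoid_laws pB sB id ->
  forall a b c,
    [/\ q (p a (p b c)) = q (p a (s b c)), q (s (p a b) c) = q (s a (s b c)),
        q (p (p a b) c) = q (p a (s b c)) & q (s (s a b) c) = q (s a (s b c))].
Proof.
move=> qp qs laws a b c; rewrite !(qp, qs).
by have [/= -> -> -> -> _] := laws (q a) (q b) (q c).
Qed.

Section DialgebraLaws.
Variables (k : fieldType) (V : lmodType k) (prec succ : V -> V -> V).

Lemma dialgebra_laws : is_dialgebra prec succ -> dimonoid_laws prec succ id.
Proof. by case=> _ [pA sA] ps sp sps a b c; split. Qed.

Definition trilinear (F : V -> V -> V -> V) :=
  [/\ forall b c, linear (fun a => F a b c), forall a c, linear (fun b => F a b c)
    & forall a b, linear (F a b)].

Lemma trilinear_left (op op' : V -> V -> V) :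
  bilin_op op -> bilin_op op' -> trilinear (fun a b c => op (op' a b) c).
Proof.
by case=> opl opr [opl' opr']; split=> x y c u v;
  rewrite ?opl' ?opr' ?opl ?opr.
Qed.

Lemma trilinear_right (op op' : V -> V -> V) :
  bilin_op op -> bilin_op op' -> trilinear (fun a b c => op a (op' b c)).
Proof.
by case=> opl opr [opl' opr']; split=> x y c u v;
  rewrite ?opl' ?opr' ?opl ?opr.
Qed.

Lemma spans_trilinear_eq (I : Type) (e : I -> V) (F G : V -> V -> V -> V) :
  spans e -> trilinear F -> trilinear G ->
  (forall a b c, F (e a) (e b) (e c) = G (e a) (e b) (e c)) ->
  forall a b c, F a b c = G a b c.
Proof.
move=> spe [F1 F2 F3] [G1 G2 G3] eFG a b c.
move: a; apply: (spans_linear_eq spe (F1 b c) (G1 b c)) => i.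
move: b; apply: (spans_linear_eq spe (F2 _ c) (G2 _ c)) => j.
by move: c; apply: (spans_linear_eq spe (F3 _ _) (G3 _ _)) => l.
Qed.

Lemma spans_dialgebra (I : Type) (e : I -> V) :
  spans e -> bilin_op prec -> bilin_op succ -> dimonoid_laws prec succ e ->
  is_dialgebra prec succ.
Proof.
move=> spe bp bs laws.
have L op op' := @trilinear_left op op'; have R op op' := @trilinear_right op op'.
split=> //; first split.
- by apply: (spans_trilinear_eq spe (R _ _ bp bp) (L _ _ bp bp)) => a b c;
    case: (laws a b c).
- by apply: (spans_trilinear_eq spe (R _ _ bs bs) (L _ _ bs bs)) => a b c;
    case: (laws a b c).
- by apply: (spans_trilinear_eq spe (R _ _ bp bs) (L _ _ bp bp)) => a b c;
    case: (laws a b c).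
- by apply: (spans_trilinear_eq spe (L _ _ bs bp) (L _ _ bs bs)) => a b c;
    case: (laws a b c).
- by apply: (spans_trilinear_eq spe (R _ _ bs bp) (L _ _ bp bs)) => a b c;
    case: (laws a b c).
Qed.

End DialgebraLaws.

Lemma hom_oeval (k : fieldType) (X : Type) (V W : lmodType k)
    (pV sV : V -> V -> V) (pW sW : W -> W -> W) (h : V -> W) (i : X -> V)
    (w : oword X) :
  dialgebra_hom pV sV pW sW h ->
  h (oeval pV sV i w) = oeval pW sW (h \o i) w.
Proof.
by case=> _ hp hs; elim: w => [x|u IHu v IHv|u IHu v IHv] //=;
  rewrite ?hp ?hs IHu IHv.
Qed.

(** * Normal forms in dimonoids *)

Section Dimonoid.
Variable X : Type.

Local Notation T := (seq X * X * seq X)%type.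

(** The products of the free dimonoid on [X], a triple being read as a word with a
    marked letter: a product of two words keeps only one of the two marks. *)
Definition diprec (s t : T) : T :=
  (s.1.1, s.1.2, s.2 ++ t.1.1 ++ t.1.2 :: t.2).
Definition disucc (s t : T) : T :=
  (s.1.1 ++ s.1.2 :: s.2 ++ t.1.1, t.1.2, t.2).
Definition divar (x : X) : T := ([::], x, [::]).

Lemma dimonoid_laws_di : dimonoid_laws diprec disucc id.
Proof.
by move=> [[a1 a2] a3] [[b1 b2] b3] [[c1 c2] c3]; split;
  rewrite /diprec /disucc /= ?cat_cons -?catA ?cat_cons -?catA.
Qed.

Definition dinf : oword X -> T := oeval diprec disucc divar.
Definition diword_of (t : T) : oword X := diword t.1.1 t.1.2 t.2.

(** The mark of [succ_comb x ys] sits on its last letter; multiplying by a letter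
    on the left with [prec] forgets it. *)
Lemma dinf_succ_comb x ys :
  diprec (divar x) (dinf (succ_comb x ys)) = ([::], x, x :: ys).
Proof.
suff H y zs : exists a b c,
    dinf (succ_comb y zs) = (a, b, c) /\ a ++ b :: c = y :: zs.
  by have [a [b [c [-> E]]]] := H x ys; rewrite /diprec /= E.
elim: zs y => [|z zs IH] y; first by exists [::], y, [::].
have [a [b [c [E1 E2]]]] := IH z; rewrite /dinf /= -/dinf in E1 *.
by exists (y :: a), b, c; rewrite E1 /= E2.
Qed.

Lemma dinf_diword t : dinf (diword_of t) = t.
Proof.
case: t => [[xs x0] ys]; rewrite /diword_of /= /diword.
elim: xs => [|x xs IH] /=; last by rewrite -[LHS]/(disucc (divar x) (dinf _)) IH.
case: ys => [|y ys] //.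
have := dinf_succ_comb y ys; rewrite /dinf /= /diprec /= => -[->] //.
Qed.

Section Eval.
Variables (A : Type) (prec succ : A -> A -> A) (i : X -> A).
Hypothesis laws : dimonoid_laws prec succ id.

Local Notation "u ≺ v" := (prec u v) (at level 40, left associativity).
Local Notation "u ≻ v" := (succ u v) (at level 40, left associativity).
Local Notation ev := (oeval prec succ i).

Let precA a b c : a ≺ (b ≺ c) = a ≺ b ≺ c. Proof. by case: (laws a b c). Qed.
Let succA a b c : a ≻ (b ≻ c) = a ≻ b ≻ c. Proof. by case: (laws a b c). Qed.
Let precS a b c : a ≺ (b ≻ c) = a ≺ b ≺ c. Proof. by case: (laws a b c). Qed.
Let succP a b c : (a ≺ b) ≻ c = a ≻ b ≻ c. Proof. by case: (laws a b c). Qed.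
Let succprec a b c : a ≻ (b ≺ c) = a ≻ b ≺ c. Proof. by case: (laws a b c). Qed.

Lemma ev_diword_cons x xs x0 ys :
  ev (diword (x :: xs) x0 ys) = i x ≻ ev (diword xs x0 ys).
Proof. by []. Qed.

Lemma ev_comb_succ y ys xs x0 zs :
  ev (succ_comb y ys) ≻ ev (diword xs x0 zs)
  = ev (diword (y :: ys ++ xs) x0 zs).
Proof. by elim: ys y => [|z ys IH] y //=; rewrite -succA IH. Qed.

(** The letters to the right of the middle letter only matter as a list: under
    [a ≺ _] the position of the middle letter of the right factor is lost. *)
Lemma prec_ev_diword a xs x0 y ys zs :
  xs ++ x0 :: zs = y :: ys ->
  a ≺ ev (diword xs x0 zs) = a ≺ ev (succ_comb y ys).
Proof.
elim: xs a y ys => [|x xs IH] a y ys.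
  by case=> <- <- /=; case: zs => [|z zs] //=; rewrite precA precS.
case=> <-; case: ys => [|z ys] E; first by case: xs E {IH}.
by rewrite ev_diword_cons precS (IH _ _ _ E) /= precS.
Qed.

(** The mark of the left factor is lost: its [prec] can be read as [succ] by the
    law that relates the two products on the left of [succ], and associativity
    then moves the letters one by one to the prefix of the right factor. *)
Lemma ev_diword_succ s t :
  ev (diword_of s) ≻ ev (diword_of t) = ev (diword_of (disucc s t)).
Proof.
case: s t => [[xs x0] ys] [[us u0] vs]; rewrite /diword_of /disucc /=.
elim: xs => [|x xs IH]; last by rewrite !ev_diword_cons -succA IH.
case: ys => [|y ys] //=.
by rewrite -[RHS]/(i x0 ≻ _) succP -succA ev_comb_succ.
Qed.

Lemma ev_diword_prec s t :
  ev (diword_of s) ≺ ev (diword_of t) = ev (diword_of (diprec s t)).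
Proof.
case: s t => [[xs x0] ys] [[us u0] vs]; rewrite /diword_of /diprec /=.
elim: xs => [|x xs IH]; last by rewrite !ev_diword_cons -succprec IH.
rewrite /diword /=; case E: (ys ++ us ++ u0 :: vs) => [|z zs].
  by case: ys us E => [|? ?] [].
case: ys E => [|y ys] E /=; first exact: prec_ev_diword.
by rewrite -precS ev_comb_succ; apply: prec_ev_diword; rewrite -E /= -catA.
Qed.

(** Words with the same value in the free dimonoid agree in every dimonoid, with
    the diword as their common normal form. *)
Lemma oeval_dinf w : ev w = ev (diword_of (dinf w)).
Proof.
elim: w => [x|u IHu v IHv|u IHu v IHv] //=.
  by rewrite IHu IHv ev_diword_prec.
by rewrite IHu IHv ev_diword_succ.
Qed.

End Eval.
End Dimonoid.

(** * The free dialgebra with basis the free dimonoid *)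

Section MonoidAlgebra.
Variables (k : fieldType) (K : choiceType).
Local Notation M := {malg k[K]}.

Definition bilin_of (op : K -> K -> K) (f g : M) : M :=
  lin_ext (fun u => lin_ext (fun v => << op u v >>) g) f.

Lemma bilin_ofU op u v : bilin_of op << u >> << v >> = << op u v >>.
Proof. by rewrite /bilin_of !lin_extU. Qed.

Lemma bilin_of_bilin op : bilin_op (bilin_of op).
Proof.
split=> [g|f c g h]; first exact: lin_ext_linear.
rewrite /bilin_of [in RHS]/lin_ext scaler_sumr -big_split.
apply: eq_bigr => u _ /=.
by rewrite lin_ext_linear scalerDr !scalerA mulrC.
Qed.

Lemma dimonoid_dialgebra (p s : K -> K -> K) :
  dimonoid_laws p s id -> is_dialgebra (bilin_of p) (bilin_of s).
Proof.
move=> laws; apply: (spans_dialgebra (@spans_malg k K)) => [||a b c].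
- exact: bilin_of_bilin.
- exact: bilin_of_bilin.
- by rewrite !bilin_ofU; have [/= -> -> -> -> ->] := laws a b c.
Qed.

Lemma oeval_bilin_of (X : Type) (p s : K -> K -> K) (i : X -> K) w :
  oeval (bilin_of p) (bilin_of s) (fun x => << i x >>) w = << oeval p s i w >>.
Proof.
by elim: w => [x|u IHu v IHv|u IHu v IHv] //=; rewrite IHu IHv bilin_ofU.
Qed.

End MonoidAlgebra.

(** * L(X|S) is the free dialgebra *)

Section FreeDialgebra.
Variables (k : fieldType) (X : choiceType).
Local Notation L := (freeL k X).
Local Notation S := (@relS k X).
Local Notation D := (freeD k X).
Local Notation pi := (toQ (@relS k X)).
Local Notation "u ≺ v" := (lprec u v) (at level 40, left associativity).
Local Notation "u ≻ v" := (lsucc u v) (at level 40, left associativity).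

Lemma bilin_extU (op : nword X -> nword X -> nword X) (u v : nword X) :
  bilin_ext op << u >> << v >> = << op u v >> :> L.
Proof.
have sU (w : nword X) : (msupp (<< w >> : L) `<=` [fset w])%fset by exact: msuppU_le.
rewrite (bilin_extEw op (sU u) (sU v)) big_seq_fset1 big_seq_fset1.
by rewrite (mcoeffUU u) (mcoeffUU v) mulr1.
Qed.

Lemma lprecU (u v : nword X) : << u >> ≺ << v >> = << nprec u v >> :> L.
Proof. exact: bilin_extU. Qed.

Lemma lsuccU (u v : nword X) : << u >> ≻ << v >> = << nsucc u v >> :> L.
Proof. exact: bilin_extU. Qed.

(** This lemma and the next three evaluate nested products from the inside, [f]
    being an inner product already known to be a basis word. *)
Lemma lprecUr (a : nword X) (f : L) (u : nword X) :
  f = << u >> -> << a >> ≺ f = << nprec a u >>.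
Proof. by move=> ->; apply: lprecU. Qed.

Lemma lsuccUr (a : nword X) (f : L) (u : nword X) :
  f = << u >> -> << a >> ≻ f = << nsucc a u >>.
Proof. by move=> ->; apply: lsuccU. Qed.

Lemma lprecUl (a : nword X) (f : L) (u : nword X) :
  f = << u >> -> f ≺ << a >> = << nprec u a >>.
Proof. by move=> ->; apply: lprecU. Qed.

Lemma lsuccUl (a : nword X) (f : L) (u : nword X) :
  f = << u >> -> f ≻ << a >> = << nsucc u a >>.
Proof. by move=> ->; apply: lsuccU. Qed.

Lemma toQ_rel (f g : L) : S (f - g) -> pi f = pi g.
Proof. by move=> Sfg; apply/toQP => J _; apply. Qed.

Lemma spans_freeD : spans (fun u : nword X => pi << u >>).
Proof.
move=> x; have [s [c E]] := spans_malg (repr x).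
by exists s, c; rewrite -linear_sum_scale -?E ?reprQ //; exact: toQ_linear.
Qed.

Lemma toQ_surj (x : D) : exists f, x = pi f.
Proof. by exists (repr x); rewrite reprQ. Qed.

Lemma bilin_toQ (op : L -> L -> L) (opQ : D -> D -> D) :
  bilin_op op -> (forall f g, pi (op f g) = opQ (pi f) (pi g)) -> bilin_op opQ.
Proof.
move=> [opl opr] opE.
have lin c f g : c *: pi f + pi g = pi (c *: f + g) by rewrite toQ_linear.
split=> y c u v; have [h ->] := toQ_surj y.
  have [f ->] := toQ_surj u; have [g ->] := toQ_surj v.
  by rewrite [X in opQ X _]lin -!opE [X in pi X]opl -lin.
have [f ->] := toQ_surj u; have [g ->] := toQ_surj v.
by rewrite [X in opQ _ X]lin -!opE [X in pi X]opr -lin.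
Qed.

Lemma bilin_lprec : bilin_op (@lprec k X).
Proof. by split; [apply: bilin_ext_linearl|apply: bilin_ext_linearr]. Qed.

Lemma bilin_lsucc : bilin_op (@lsucc k X).
Proof. by split; [apply: bilin_ext_linearl|apply: bilin_ext_linearr]. Qed.

Lemma bilin_precQ : bilin_op (@precQ k X S).
Proof. exact: (bilin_toQ bilin_lprec (toQ_prec S)). Qed.

Lemma bilin_succQ : bilin_op (@succQ k X S).
Proof. exact: (bilin_toQ bilin_lsucc (toQ_succ S)). Qed.

Lemma lsucc_lprecU (a b c : nword X) :
  << a >> ≻ (<< b >> ≺ << c >>) = (<< a >> ≻ << b >>) ≺ << c >> :> L.
Proof.
have El := lsuccUr a (lprecU b c); have Er := lprecUl c (lsuccU a b).
by apply: etrans El (etrans _ (esym Er)); congr << _ >>; apply: val_inj.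
Qed.

Lemma freeD_dialgebra : is_dialgebra (@precQ k X S) (@succQ k X S).
Proof.
apply: (spans_dialgebra spans_freeD bilin_precQ bilin_succQ).
apply: (dimonoid_laws_image (toQ_prec S) (toQ_succ S)) => a b c; split.
- by apply: toQ_rel; constructor 1; exists a, b, c.
- by apply: toQ_rel; constructor 2; exists a, b, c.
- by apply: toQ_rel; constructor 3; exists a, b, c.
- by apply: toQ_rel; constructor 4; exists a, b, c.
- exact: (congr1 pi (lsucc_lprecU a b c)).
Qed.

(** In a normal word [Prec u v] the factor [u] is not of the form [Succ u1 u2], so
    the product in L(X) of the two factors is the word itself. *)
Lemma toQ_word (u : nword X) :
  pi << u >> = oeval (@precQ k X S) (@succQ k X S) (@genQ k X S) u.
Proof.
case: u => w; elim: w => [x|w1 IH1 w2 IH2|w1 IH1 w2 IH2] /= nw.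
- by congr (pi << _ >>); apply: val_inj.
- have /and3P[n1 n2 s1] := nw; rewrite -(IH1 n1) -(IH2 n2) -toQ_prec lprecU.
  by congr (pi << _ >>); apply: val_inj => /=; case: w1 s1 {IH1 nw n1}.
- have /andP[n1 n2] := nw; rewrite -(IH1 n1) -(IH2 n2) -toQ_succ lsuccU.
  by congr (pi << _ >>); apply: val_inj.
Qed.

Section Universal.
Variables (W : lmodType k) (precW succW : W -> W -> W).
Hypothesis dialgW : is_dialgebra precW succW.
Variable j : X -> W.

Local Notation ev := (oeval precW succW j).

Definition evalL : L -> W := lin_ext (fun u : nword X => ev u).

Lemma evalLU (u : nword X) : evalL << u >> = ev u.
Proof. exact: lin_extU. Qed.

Lemma evalL_linear : linear evalL. Proof. exact: lin_ext_linear. Qed.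

Lemma evalLB f g : evalL (f - g) = evalL f - evalL g.
Proof.
have -> : f - g = -1 *: g + f by rewrite scaleN1r addrC.
by rewrite evalL_linear scaleN1r addrC.
Qed.

Lemma evalL_eqB f g : evalL f = evalL g -> evalL (f - g) = 0.
Proof. by move=> E; rewrite evalLB E subrr. Qed.

(** Moving a product [_ prec v] below the operations [succ] of [u], as the product
    of L(X) does, is one of the dialgebra laws. *)
Lemma ev_wprec (u v : oword X) : ev (wprec u v) = precW (ev u) (ev v).
Proof.
have laws := dialgebra_laws dialgW.
elim: u => //= u1 _ u2 ->; by have [_ _ _ _ ->] := laws (ev u1) (ev u2) (ev v).
Qed.

Lemma linear_bilin_eq (op : L -> L -> L) (opW : W -> W -> W) :
  bilin_op op -> bilin_op opW ->
  (forall u v : nword X, evalL (op << u >> << v >>) = opW (ev u) (ev v)) ->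
  forall f g, evalL (op f g) = opW (evalL f) (evalL g).
Proof.
move=> [opl opr] [Wl Wr] opU f g; have spL := @spans_malg k (nword X).
move: f; apply: (spans_linear_eq spL) => [c f1 f2|c f1 f2|u].
- by rewrite opl evalL_linear.
- by rewrite evalL_linear Wl.
move: g; apply: (spans_linear_eq spL) => [c f1 f2|c f1 f2|v].
- by rewrite opr evalL_linear.
- by rewrite evalL_linear Wr.
exact: etrans (opU u v) (esym (congr2 opW (evalLU u) (evalLU v))).
Qed.

Lemma evalL_prec f g : evalL (f ≺ g) = precW (evalL f) (evalL g).
Proof.
have [[bp _] _ _ _ _] := dialgW.
apply: linear_bilin_eq => // [|u v]; last by rewrite lprecU evalLU ev_wprec.
exact: bilin_lprec.
Qed.

Lemma evalL_succ f g : evalL (f ≻ g) = succW (evalL f) (evalL g).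
Proof.
have [[_ bs] _ _ _ _] := dialgW.
apply: linear_bilin_eq => // [|u v]; last by rewrite lsuccU evalLU.
exact: bilin_lsucc.
Qed.

Lemma evalL_ker_ideal : is_ideal (fun f => evalL f = 0).
Proof.
have [[[pl pr] [sl sr]] _ _ _ _] := dialgW.
split=> [|c f g f0 g0|f g f0].
- exact: (linear0_eq evalL_linear).
- by rewrite evalL_linear f0 g0 scaler0 addr0.
split.
- by rewrite evalL_prec f0; apply: (linear0_eq (pl (evalL g))).
- by rewrite evalL_prec f0; apply: (linear0_eq (pr (evalL g))).
- by rewrite evalL_succ f0; apply: (linear0_eq (sl (evalL g))).
- by rewrite evalL_succ f0; apply: (linear0_eq (sr (evalL g))).
Qed.

Lemma evalL_rel f : S f -> evalL f = 0.
Proof.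
have eqs := dimonoid_eqs evalL_prec evalL_succ (dialgebra_laws dialgW).
case=> -[a [b [c ->]]]; have [E1 E2 E3 E4] := eqs << a >> << b >> << c >>.
- exact: (evalL_eqB E1).
- exact: (evalL_eqB E2).
- exact: (evalL_eqB E3).
- exact: (evalL_eqB E4).
Qed.

Lemma evalL_toQ f g : pi f = pi g -> evalL f = evalL g.
Proof.
move/toQP => Ifg; apply/eqP; rewrite -subr_eq0 -evalLB; apply/eqP.
by apply: (Ifg (fun h => evalL h = 0)); [apply: evalL_ker_ideal|apply: evalL_rel].
Qed.

Definition evalD (x : D) : W := evalL (repr x).

Lemma evalD_toQ f : evalD (pi f) = evalL f.
Proof. by apply: evalL_toQ; rewrite reprQ. Qed.

Lemma evalD_hom :
  dialgebra_hom (@precQ k X S) (@succQ k X S) precW succW evalD.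
Proof.
split=> [c x y|x y|x y]; have [f ->] := toQ_surj x; have [g ->] := toQ_surj y.
- have -> : c *: pi f + pi g = pi (c *: f + g) by rewrite toQ_linear.
  by rewrite !evalD_toQ evalL_linear.
- by rewrite -toQ_prec !evalD_toQ evalL_prec.
- by rewrite -toQ_succ !evalD_toQ evalL_succ.
Qed.

Lemma evalD_gen x : evalD (@genQ k X S x) = j x.
Proof. by rewrite evalD_toQ evalLU. Qed.

Lemma evalD_uniq (h : D -> W) :
  dialgebra_hom (@precQ k X S) (@succQ k X S) precW succW h ->
  (forall x, h (@genQ k X S x) = j x) -> h =1 evalD.
Proof.
move=> hh hj; have [linh _ _] := hh; have [lind _ _] := evalD_hom.
apply: (spans_linear_eq spans_freeD) => // u.
rewrite toQ_word (hom_oeval _ _ hh) (hom_oeval _ _ evalD_hom).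
by congr (oeval _ _ _ _); apply/funext => x /=; rewrite hj evalD_gen.
Qed.

End Universal.

Lemma freeD_free :
  is_free_dialgebra (@precQ k X S) (@succQ k X S) (@genQ k X S).
Proof.
split=> [|W precW succW dialgW j]; first exact: freeD_dialgebra.
exists (evalD precW succW j); split.
- exact: evalD_hom.
- exact: evalD_gen.
- by move=> h hh hj v; apply: evalD_uniq.
Qed.

Definition diQ (t : seq X * X * seq X) : D :=
  oeval (@precQ k X S) (@succQ k X S) (@genQ k X S) (diword_of t).

(** A normal word has the same class as its diword, so the diwords span; in the
    dialgebra of the free dimonoid they become the standard basis. *)
Lemma freeD_basis : is_basis diQ.
Proof.
split=> [s c us | ].
  have dW := dimonoid_dialgebra k (@dimonoid_laws_di X).
  have [h [hh hg _]] := (freeD_free).2 _ _ _ dW (fun x => << divar x >>).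
  have [linh _ _] := hh; apply: (free_of_malg linh) us => t.
  rewrite (hom_oeval _ _ hh) -{2}[t]dinf_diword -oeval_bilin_of.
  by congr (oeval _ _ _ _); apply/funext => x; apply: hg.
apply: (spans_factor (phi := fun u : nword X => dinf u)) => v.
have [s [c ->]] := spans_freeD v; exists s, c; apply: eq_bigr => u _.
by rewrite toQ_word (oeval_dinf _ (dialgebra_laws freeD_dialgebra)).
Qed.

End FreeDialgebra.

(** * The words of the basis are the irreducible words *)

Section Irreducible.
Variables (d : Order.disp_t) (X : orderType d).

Fixpoint is_comb (w : oword X) : bool :=
  if w is Succ (Var _) v then is_comb v else if w is Var _ then true else false.

Fixpoint is_di (w : oword X) : bool :=
  match w with
  | Var _ => true
  | Succ (Var _) v => is_di v
  | Prec (Var _) v => is_comb v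
  | _ => false
  end.

Lemma is_combP (w : oword X) :
  reflect (exists x ys, w = succ_comb x ys) (is_comb w).
Proof.
apply: (iffP idP) => [|[x [ys ->]]]; last by elim: ys x => //= y ys IH x.
elim: w => [x|//|[x||] _ v IH] //=; first by exists x, [::].
by move=> /IH[y [ys ->]]; exists x, (y :: ys).
Qed.

Lemma is_diP (w : oword X) :
  reflect (exists xs x0 ys, w = diword xs x0 ys) (is_di w).
Proof.
apply: (iffP idP) => [|[xs [x0 [ys ->]]]].
  elim: w => [x|[x||] _ v _|[x||] _ v IH] //=; first by exists [::], x, [::].
    by move=> /is_combP[y [ys ->]]; exists [::], x, (y :: ys).
  by move=> /IH[xs [x0 [ys ->]]]; exists (x :: xs), x0, ys.
elim: xs => [|x xs IH] //=; case: ys => [|y ys] //=.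
by apply/is_combP; exists y, ys.
Qed.

Lemma comb_di (w : oword X) : is_comb w -> is_di w.
Proof. by elim: w => [||[]]. Qed.

Lemma di_normal (w : oword X) : is_di w -> normal w.
Proof.
have comb_normal v : is_comb v -> normal v by elim: v => [||[]].
by elim: w => [x|[x||] _ v _|[x||] _ v IH] //= /comb_normal ->.
Qed.

(** Diwords are closed under taking subwords, so a diword can only contain leading
    words that are diwords themselves. *)
Lemma di_star (v : oword (option X)) (u : oword X) :
  (0 < nstar v)%N -> is_di (star_subst v u) -> is_di u.
Proof.
elim: v => [[x|]|v1 IH1 v2 IH2|v1 IH1 v2 IH2] //=; rewrite addn_gt0.
  case: v1 IH1 => [[x|]||] IH1 //=; last by rewrite /star_subst /=; case: u IH1 IH2.
  by rewrite /star_subst /= => + /comb_di; exact: IH2.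
by case: v1 IH1 => [[x|]||] IH1 //=; rewrite /star_subst /=; case: u IH1 IH2.
Qed.

Lemma wltxx (w : oword X) : wlt w w = false.
Proof.
by elim: w => [x|u IHu v IHv|u IHu v IHv] /=; rewrite ?ltnn ?eqxx ?ltxx // IHu IHv.
Qed.

Lemma wsize_gt0 (w : oword X) : (0 < wsize w)%N.
Proof. by elim: w => //= u IHu v IHv; rewrite addn_gt0 IHu. Qed.

Lemma wsize_wprec (u v : oword X) : wsize (wprec u v) = (wsize u + wsize v)%N.
Proof. by elim: u => //= u1 _ u2 ->; rewrite addnA. Qed.

Lemma wsize_gtD (u v : oword X) : (wsize u < wsize u + wsize v)%N.
Proof. by rewrite -[ltnLHS]addn0 ltn_add2l wsize_gt0. Qed.

Lemma wlt_size (u v : oword X) : wlt u v -> (wsize u <= wsize v)%N.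
Proof. by case: u v => [x|u1 u2|u1 u2] [y|v1 v2|v1 v2] //=; case: ltngtP. Qed.

Lemma ltn_wsize (u v : oword X) : (wsize u < wsize v)%N -> wlt u v.
Proof. by case: u v => [x|u1 u2|u1 u2] [y|v1 v2|v1 v2] //= ->. Qed.

(** The order refines the size, so in a lexicographic comparison the size need not
    be compared first; hence the order is stable under left contexts. *)
Lemma wlt_lex (u v : oword X) :
  (wsize u < wsize v)%N || (wsize u == wsize v) && wlt u v = wlt u v.
Proof.
case: ltngtP => [/ltn_wsize -> //|lt_vu|//].
by apply/esym/negP => /wlt_size; rewrite leqNgt lt_vu.
Qed.

Lemma wlt_Succ2l (u v w : oword X) : wlt (Succ u v) (Succ u w) = wlt v w.
Proof. by rewrite /= wltxx eqxx ltn_add2l eqn_add2l wlt_lex. Qed.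

Lemma wlt_Prec2l (u v w : oword X) : wlt (Prec u v) (Prec u w) = wlt v w.
Proof. by rewrite /= wltxx eqxx ltn_add2l eqn_add2l wlt_lex. Qed.

Lemma wlt_wprec2l (u v w : oword X) : wlt (wprec u v) (wprec u w) = wlt v w.
Proof.
by elim: u => [x|a _ b _|a _ b IH]; [exact: wlt_Prec2l..|rewrite wlt_Succ2l].
Qed.

Lemma wlt_foldr_Succ (s : seq (oword X)) (p q : oword X) :
  wlt (foldr (@Succ X) p s) (foldr (@Succ X) q s) = wlt p q.
Proof. by elim: s => // a s IH; rewrite wlt_Succ2l. Qed.

Lemma wprecE (u v : oword X) : ~~ is_succ u -> wprec u v = Prec u v.
Proof. by case: u. Qed.

Lemma di_wprec (a p : oword X) : is_di (wprec a p) -> is_comb p.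
Proof. by elim: a => [x|[]|[x||] _ c IH] //=. Qed.

Lemma comb_wprec (a p : oword X) : is_comb (wprec a p) = false.
Proof. by elim: a => [x||[]]. Qed.

Lemma comb_foldr_Succ (s : seq (oword X)) (p : oword X) :
  is_comb (foldr (@Succ X) p s) -> is_comb p.
Proof. by elim: s => //= -[x||] s IH. Qed.

(** Which word of a relation [p - q] is the leading one may depend on the words
    that occur in it: in [a prec (b prec c) - a prec (b succ c)] it is the first
    one unless [b] is itself a product [b1 succ b2]. *)
Definition reducing (p q : oword X) :=
  (wlt q p -> ~~ is_di p) /\ (wlt p q -> ~~ is_di q).

(** The common context [a prec (s1 succ (s2 succ ...))] preserves the order, which
    leaves [wprec b c] to be compared with [Succ b c]. If the latter is the larger
    one, [b] is not a letter, so [Succ b c] is not a chain of letters. *)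
Lemma reducing_prec (a b c : oword X) (s : seq (oword X)) :
  reducing (wprec a (foldr (@Succ X) (wprec b c) s))
           (wprec a (foldr (@Succ X) (Succ b c) s)).
Proof.
split=> [_|]; last rewrite wlt_wprec2l wlt_foldr_Succ => lt;
  apply/negP => /di_wprec/comb_foldr_Succ.
  by rewrite comb_wprec.
by case: b lt => [x||] //=; rewrite addnC ltnn andbF.
Qed.

Lemma wsize_gtN (u w : oword X) (t : bool) :
  (wsize u < wsize w)%N -> wlt w u || (w == u) && t = false.
Proof.
move=> lt_uw; apply/negP => /orP[/wlt_size|/andP[/eqP E _]].
  by rewrite leqNgt lt_uw.
by rewrite E ltnn in lt_uw.
Qed.

(** Associating to the left enlarges the left factor, so the word that is
    associated to the left is the larger one. *)
Lemma reducing_succ (a b c u : oword X) :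
  wsize u = (wsize a + wsize b)%N ->
  is_di (Succ u c) = false -> reducing (Succ u c) (Succ a (Succ b c)).
Proof.
move=> su ndi; split=> [_|]; first by rewrite ndi.
rewrite /= su addnA ltnn eqxx /= wsize_gtN //.
by rewrite su wsize_gtD.
Qed.

Lemma reducing_wprec (a b c : oword X) :
  reducing (wprec (wprec a b) c) (wprec a (Succ b c)).
Proof.
have gen u w : wsize w = (wsize u + wsize b)%N ->
    wlt (Prec w c) (Prec u (Succ b c)) = false.
  move=> sw; rewrite /= sw addnA ltnn eqxx /= wsize_gtN //.
  by rewrite sw wsize_gtD.
have base u : wlt (Prec (Prec u b) c) (Prec u (Succ b c)) = false by exact: gen.
split=> [_|]; first by elim: a => [x|//|[x||] _ v IH] //=.
elim: a => [x|a1 _ a2 _|a1 _ a2 IH]; [by rewrite base|by rewrite base|].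
by rewrite wlt_Succ2l => /IH; case: a1.
Qed.

Section Relations.
Variable k : fieldType.
Local Notation L := (freeL k X).
Local Notation "u ≺ v" := (lprec u v) (at level 40, left associativity).
Local Notation "u ≻ v" := (lsucc u v) (at level 40, left associativity).

Lemma mcoeff_sub2 (p q v : nword X) :
  (<< p >> - << q >> : L)@_v = (p == v)%:R - (q == v)%:R.
Proof.
exact: etrans (mcoeffB v _ _)
              (congr2 (fun x y => x - y) (mcoeffU p 1 v) (mcoeffU q 1 v)).
Qed.

Lemma leading_sub (p q : nword X) : wlt q p -> leading (<< p >> - << q >> : L) p.
Proof.
move=> lt_qp; have qp : q != p by apply: contraTneq lt_qp => ->; rewrite wltxx.
split=> [|v]; rewrite -mcoeff_neq0 mcoeff_sub2.
  by rewrite eqxx (negPf qp) subr0 oner_neq0.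
move=> + /negPf vp; rewrite [p == v]eq_sym vp sub0r.
by case: (q =P v) => [<-|_] //; rewrite oppr0 eqxx.
Qed.

Lemma leading_subP (p q u : nword X) : leading (<< p >> - << q >> : L) u ->
  u = p /\ wlt q p \/ u = q /\ wlt p q.
Proof.
case: (eqVneq p q) => [->|pq] [].
  by rewrite -mcoeff_neq0 mcoeff_sub2 subrr eqxx.
have supp v : v \in msupp (<< p >> - << q >> : L) = (v == p) || (v == q).
  rewrite -mcoeff_neq0 mcoeff_sub2 ![_ == v]eq_sym.
  case: (v =P p) => [->|_]; first by rewrite (negPf pq) subr0 oner_neq0.
  by case: (v == q); rewrite ?sub0r ?subr0 ?oppr_eq0 ?oner_neq0 ?eqxx.
rewrite supp => /orP[] /eqP -> lead; [left|right]; split=> //; apply: lead.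
- by rewrite supp eqxx orbT.
- by rewrite eq_sym.
- by rewrite supp eqxx.
- by [].
Qed.

Lemma val_foldr_nsucc (s : seq (nword X)) (u : nword X) :
  foldr (@nsucc X) u s = foldr (@Succ X) u (map (@nword_val X) s) :> oword X.
Proof. by elim: s => //= a s ->. Qed.

Lemma succsU (s : seq (nword X)) (f : L) (u : nword X) :
  f = << u >> -> succs s f = << foldr (@nsucc X) u s >>.
Proof. by move=> fu; elim: s => [|a s IH]; [exact: fu|exact: (lsuccUr a IH)]. Qed.

(** The pairs of normal words whose differences are the relations. Both [F1]
    (for [s] empty) and [F5] (for [s] nonempty) come from the first constructor. *)
Inductive rel_words : nword X -> nword X -> Prop :=
| RelPrec a s b c :
    rel_words (nprec a (foldr (@nsucc X) (nprec b c) s))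
              (nprec a (foldr (@nsucc X) (nsucc b c) s))
| RelPrecSucc a b c :
    rel_words (nsucc (nprec a b) c) (nsucc a (nsucc b c))
| RelPrecPrec a b c :
    rel_words (nprec (nprec a b) c) (nprec a (nsucc b c))
| RelSuccSucc a b c :
    rel_words (nsucc (nsucc a b) c) (nsucc a (nsucc b c)).

(** All products of basis words in L(X) are basis words, so each relation is a
    difference of two normal words. *)
Lemma relS1P (f : L) :
  relS1 f <-> exists p q, rel_words p q /\ f = << p >> - << q >>.
Proof.
have sub (f1 f2 g1 g2 : L) : f1 = g1 -> f2 = g2 -> f1 - f2 = g1 - g2.
  by move=> -> ->.
have E1 a s b c := lprecUr a (succsU s (lprecU k b c)).
have E1' a s b c := lprecUr a (succsU s (lsuccU k b c)).
have E2 (a b c : nword X) := lsuccUl c (lprecU k a b).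
have E2' (a b c : nword X) := lsuccUr a (lsuccU k b c).
have E3 (a b c : nword X) := lprecUl c (lprecU k a b).
have E3' (a b c : nword X) := lprecUr a (lsuccU k b c).
have E4 (a b c : nword X) := lsuccUl c (lsuccU k a b).
split=> [[[] [a [b [c ->]]]|[a [s [b [c [_ ->]]]]]] | [p [q [pq ->]]]].
- exists (nprec a (nprec b c)), (nprec a (nsucc b c)).
  by split; [exact: (RelPrec a [::] b c)
            |exact: (sub _ _ _ _ (E1 a [::] b c) (E1' a [::] b c))].
- exists (nsucc (nprec a b) c), (nsucc a (nsucc b c)).
  by split; [exact: RelPrecSucc|exact: (sub _ _ _ _ (E2 a b c) (E2' a b c))].
- exists (nprec (nprec a b) c), (nprec a (nsucc b c)).
  by split; [exact: RelPrecPrec|exact: (sub _ _ _ _ (E3 a b c) (E3' a b c))].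
- exists (nsucc (nsucc a b) c), (nsucc a (nsucc b c)).
  by split; [exact: RelSuccSucc|exact: (sub _ _ _ _ (E4 a b c) (E2' a b c))].
- exists (nprec a (foldr (@nsucc X) (nprec b c) s)),
         (nprec a (foldr (@nsucc X) (nsucc b c) s)).
  by split; [exact: RelPrec|exact: (sub _ _ _ _ (E1 a s b c) (E1' a s b c))].
case: p q / pq => [a s b c|a b c|a b c|a b c].
- case: s => [|z s].
    left; constructor 1; exists a, b, c.
    exact: (sub _ _ _ _ (esym (E1 a [::] b c)) (esym (E1' a [::] b c))).
  right; exists a, (z :: s), b, c; split; first by [].
  exact: (sub _ _ _ _ (esym (E1 a (z :: s) b c)) (esym (E1' a (z :: s) b c))).
- left; constructor 2; exists a, b, c.
  exact: (sub _ _ _ _ (esym (E2 a b c)) (esym (E2' a b c))).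
- left; constructor 3; exists a, b, c.
  exact: (sub _ _ _ _ (esym (E3 a b c)) (esym (E3' a b c))).
- left; constructor 4; exists a, b, c.
  exact: (sub _ _ _ _ (esym (E4 a b c)) (esym (E2' a b c))).
Qed.

Lemma rel_words_reducing (p q : nword X) : rel_words p q -> reducing p q.
Proof.
case=> [a s b c|a b c|a b c|a b c] /=.
- by rewrite !val_foldr_nsucc; exact: reducing_prec.
- by apply: reducing_succ; [exact: wsize_wprec|case: (nword_val a)].
- exact: reducing_wprec.
- exact: reducing_succ.
Qed.

Lemma di_Irr (w : oword X) : is_di w -> Irr (@relS1 k X) w.
Proof.
move=> di_w; split; first exact: di_normal.
case=> f [u [v [/relS1P[p [q [pq ->]]] lead star E]]].
have di_u : is_di u by apply: (@di_star v); rewrite ?star // -E.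
have [red_p red_q] := rel_words_reducing pq.
by case: (leading_subP lead) => -[eu] => [/red_p|/red_q]; rewrite -eu di_u.
Qed.

Definition reducible (w : oword X) :=
  exists (s : L) (u : nword X) (v : oword (option X)),
    [/\ relS1 s, leading s u, nstar v = 1%N & w = star_subst v u].

Definition no_star : oword X -> oword (option X) :=
  oeval (@Prec _) (@Succ _) (fun x => Var (Some x)).

Lemma nstar_no_star w : nstar (no_star w) = 0%N.
Proof. by rewrite /no_star; elim: w => //= u -> v ->. Qed.

Lemma star_subst_no_star w u : star_subst (no_star w) u = w.
Proof. by rewrite /star_subst /no_star; elim: w => //= a -> b ->. Qed.

Lemma reducible_ctx (u v w : oword X) :
  w = Prec u v \/ w = Succ u v -> reducible u \/ reducible v -> reducible w.
Proof.
by case=> ->; case=> -[s [l [c [rs ls star ->]]]]; exists s, l;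
  [exists (Prec c (no_star v))|exists (Prec (no_star u) c)
  |exists (Succ c (no_star v))|exists (Succ (no_star u) c)];
  rewrite /= ?nstar_no_star ?star ?addn0 /star_subst /= -!/(star_subst _ _)
    ?star_subst_no_star.
Qed.

Lemma reducible_rel (p q : nword X) :
  rel_words p q -> wlt q p -> reducible p.
Proof.
move=> pq lt_qp; exists (<< p >> - << q >>), p, (Var None); split=> //.
  by apply/relS1P; exists p, q.
exact: leading_sub.
Qed.

(** The shape [s1 succ (... succ (b prec c))] is that of the right factor in the
    first family of [rel_words]; the condition on [b] makes the leading word of
    the relation the one with [b prec c]. *)
Lemma di_not_comb (v : oword X) : is_di v -> ~~ is_comb v ->
  exists (s : seq (nword X)) (b c : nword X), ~~ is_succ b /\
    v = foldr (@nsucc X) (nprec b c) s.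
Proof.
elim: v => [//|[x||] _ v _|[x||] _ v IH] //=.
  move=> cv _; exists [::], (nvar x), (NWord (di_normal (comb_di cv))); split=> //.
move=> dv ncv; have [s [b [c [nb ->]]]] := IH dv ncv.
by exists (nvar x :: s), b, c.
Qed.

(** By induction the two factors of the word may be assumed to be diwords. Then
    the word itself is not a diword in one of four ways, each of which is the
    larger word of one constructor of [rel_words]. *)
Lemma not_di_reducible (w : oword X) : normal w -> ~~ is_di w -> reducible w.
Proof.
elim: w => [//|u IHu v IHv|u IHu v IHv] /=.
- case/and3P=> nu nv su.
  have [du|/(IHu nu) ru _] := boolP (is_di u); last first.
    by apply: (@reducible_ctx u v); [left|left].
  have [dv|/(IHv nv) rv _] := boolP (is_di v); last first.
    by apply: (@reducible_ctx u v); [left|right].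
  case: u {IHu} nu su du => [x|u1 u2|//] /=.
    move=> _ _ _ /(di_not_comb dv)[s [b [c [nb E]]]].
    have -> : Prec (Var x) v = nprec (nvar x) (foldr (@nsucc X) (nprec b c) s).
      by rewrite E.
    apply: reducible_rel (RelPrec (nvar x) s b c) _.
    rewrite [wlt _ _]wlt_wprec2l !val_foldr_nsucc wlt_foldr_Succ /=.
    by rewrite wprecE //= ltnn eqxx.
  case/and3P=> n1 n2 ns1 _ _ _.
  pose a := NWord n1; pose b := NWord n2; pose c := NWord nv.
  have -> : Prec (Prec u1 u2) v = nprec (nprec a b) c by rewrite /= !(wprecE _ ns1).
  apply: reducible_rel (RelPrecPrec a b c) _.
  by rewrite /= !(wprecE _ ns1) /= addnA ltnn eqxx ltn_wsize //= wsize_gtD.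
- case/andP=> nu nv.
  have [du|/(IHu nu) ru _] := boolP (is_di u); last first.
    by apply: (@reducible_ctx u v); [right|left].
  have [dv|/(IHv nv) rv _] := boolP (is_di v); last first.
    by apply: (@reducible_ctx u v); [right|right].
  case: u {IHu} nu du => [x|u1 u2|u1 u2] /=; first by [].
    case/and3P=> n1 n2 ns1 _ _.
    pose a := NWord n1; pose b := NWord n2; pose c := NWord nv.
    have -> : Succ (Prec u1 u2) v = nsucc (nprec a b) c by rewrite /= wprecE.
    apply: reducible_rel (RelPrecSucc a b c) _.
    by rewrite /= wprecE //= addnA ltnn eqxx ltn_wsize //= wsize_gtD.
  case/andP=> n1 n2 _ _.
  apply: reducible_rel (RelSuccSucc (NWord n1) (NWord n2) (NWord nv)) _.
  by rewrite /= addnA ltnn eqxx ltn_wsize //= wsize_gtD.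
Qed.

Lemma Irr_di (w : oword X) : Irr (@relS1 k X) w <-> is_di w.
Proof.
split=> [[nw irr_w]|]; last exact: di_Irr.
by apply/negPn/negP => /(not_di_reducible nw)/irr_w.
Qed.

End Relations.
End Irreducible.

Theorem corollary5p7 (k : fieldType) (d : Order.disp_t) (X : orderType d)
    (X_wf : well_founded (fun x y : X => (x < y)%O)) :
  [/\ @is_free_dialgebra k X (freeD k X)
        (@precQ k X (@relS k X)) (@succQ k X (@relS k X)) (@genQ k X (@relS k X)),
      @is_basis k (seq X * X * seq X)%type (freeD k X)
        (fun t => oeval (@precQ k X (@relS k X)) (@succQ k X (@relS k X))
                    (@genQ k X (@relS k X)) (diword t.1.1 t.1.2 t.2))
    & forall w : oword X,
        (exists (xs : seq X) (x0 : X) (ys : seq X), w = diword xs x0 ys) <->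
        Irr (@relS1 k X) w].
Proof.
split=> [||w]; [exact: freeD_free|exact: freeD_basis|].
by split=> [/is_diP|/Irr_di]; [move/Irr_di|move/is_diP].
Qed.
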